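(* Suppose $\mathcal{D}(M_v)$ is dense in $L^2(\mu)$ and let $k\ge1$ be a fixed integer. For $n\ge1$ put $\triangle_{v,n}(t)=\sum_{0\le i\le n}(-1)^i\binom{n}{i}|v(t)|^{2i}$. Then: (i) $M_v$ is $k$-hyperexpansive if and only if $\triangle_{v,n}(t)\le0$ a.e. $\mu$ for $n=1,2,\dots,k$; (ii) $M_v$ is completely hyperexpansive if and only if the sequence $\{|v(t)|^{2n}\}_{n=0}^\infty$ is completely alternating for almost every $t\in\Omega$.
   Context: $(\Omega,\Sigma,\mu)$ is a $\sigma$-finite measure space, $L^2(\mu)=L^2(\Omega,\Sigma,\mu)$ (complex-valued functions), and $v:\Omega\to\mathbb{C}$ is $\Sigma$-measurable. The multiplication operator $M_v$ in $L^2(\mu)$ is $f\mapsto vf$ with domain $\mathcal{D}(M_v)=\{f\in L^2(\mu): vf\in L^2(\mu)\}$. For an operator $T$ in a Hilbert space and $n\ge1$, put $\Theta_{T,n}(f)=\sum_{0\le i\le n}(-1)^i\binom{n}{i}\|T^i f\|^2$ for $f\in\mathcal{D}(T^n)$. $T$ is $k$-hyperexpansive ($k\ge1$) if $\Theta_{T,n}(f)\le0$ for all $f\in\mathcal{D}(T^n)$ and $n=1,\dots,k$; $T$ is completely hyperexpansive if $\Theta_{T,n}(f)\le0$ for all $f\in\mathcal{D}(T^n)$ and all $n\ge1$. A real sequence $\{\phi(n)\}_{n\ge0}$ is completely alternating if $\sum_{0\le i\le n}(-1)^i\binom{n}{i}\phi(m+i)\le0$ for all $m\ge0$ and $n\ge1$.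 *)

(* Defs.v *)
From HB Require Import structures.
From mathcomp Require Import all_boot all_order all_algebra.
From mathcomp Require Import generic_quotient ring_quotient complex.
From mathcomp Require Import all_classical all_reals all_analysis.
From mathcomp Require Import measurable_realfun.

Set Implicit Arguments.
Unset Strict Implicit.
Unset Printing Implicit Defensive.

Import Order.TTheory GRing.Theory Num.Theory.
Import numFieldNormedType.Exports.

Local Open Scope classical_set_scope.
Local Open Scope ring_scope.
Local Open Scope quotient_scope.

(* Not necessarily bounded, not necessarily densely defined linear operators.
   [op_fun] is total, but only its values on [op_dom] are meaningful. *)
Record operator (K : numFieldType) (V : normedModType K) := Operator {
  op_dom : set V;
  op_fun :> V -> V;
  op_dom0 : op_dom 0;
  op_domP : forall a f g, op_dom f -> op_dom g -> op_dom (a *: f + g);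
  op_linear : forall a f g, op_dom f -> op_dom g ->
    op_fun (a *: f + g) = a *: op_fun f + op_fun g }.

Section Operators.
Context {K : numFieldType} {V : normedModType K}.
Implicit Types S T : operator V.

Lemma op_fun0 T : T 0 = 0.
Proof.
have := op_linear (-1) (op_dom0 T) (op_dom0 T).
by rewrite addr0 scaler0 scaleN1r addNr.
Qed.

Definition op_id : operator V :=
  @Operator K V setT id I (fun _ _ _ _ _ => I) (fun _ _ _ _ _ => erefl).

Definition comp_dom S T : set V := [set f | op_dom T f /\ op_dom S (T f)].

Lemma comp_dom0 S T : comp_dom S T 0.
Proof. by split; rewrite ?op_fun0; exact: op_dom0. Qed.

Lemma comp_domP S T a f g :
  comp_dom S T f -> comp_dom S T g -> comp_dom S T (a *: f + g).
Proof.
move=> [Tf STf] [Tg STg]; split; first exact: op_domP.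
by rewrite op_linear//; exact: op_domP.
Qed.

Lemma comp_linear S T a f g : comp_dom S T f -> comp_dom S T g ->
  S (T (a *: f + g)) = a *: S (T f) + S (T g).
Proof. by move=> [Tf STf] [Tg STg]; rewrite !op_linear. Qed.

Definition op_comp S T : operator V :=
  @Operator K V (comp_dom S T) (S \o T)
    (comp_dom0 S T) (@comp_domP S T) (@comp_linear S T).

Definition op_exp T n : operator V := iter n (op_comp T) op_id.

(* The values are in K; when K is the field of complex numbers, [z <= 0] means
   that z is real and nonpositive (and Theta T n f is always real). *)
Definition Theta T n (f : V) : K :=
  \sum_(0 <= i < n.+1) (-1) ^+ i * 'C(n, i)%:R * `|op_exp T i f| ^+ 2.

Definition hyperexpansive k T :=
  forall n, (1 <= n <= k)%N ->
  forall f, op_dom (op_exp T n) f -> Theta T n f <= 0.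

Definition completely_hyperexpansive T :=
  forall n, (1 <= n)%N ->
  forall f, op_dom (op_exp T n) f -> Theta T n f <= 0.

End Operators.

Definition completely_alternating (R : realType) (phi : nat -> R) :=
  forall m n, (1 <= n)%N ->
  \sum_(0 <= i < n.+1) (-1) ^+ i * 'C(n, i)%:R * phi (m + i)%N <= 0.

(* The real-valued modulus of a complex number ([`|z|] is in R[i]). *)
Notation cmod := (@Normc.normc _).

Lemma cmod_ge0 (R : realType) (z : R[i]) : 0 <= cmod z.
Proof. by case: z => a b; exact: sqrtr_ge0. Qed.

Definition triangle (R : realType) (T : Type) (v : T -> R[i]) n (t : T) : R :=
  \sum_(0 <= i < n.+1) (-1) ^+ i * 'C(n, i)%:R * cmod (v t) ^+ (2 * i).

Section ComplexMeasurable.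
Context d (T : measurableType d) (R : realType).
Implicit Types f g v : T -> R[i].

(* Measurability for the Borel sigma-algebra of C = R x R. *)
Definition cmeasurable f :=
  measurable_fun [set: T] (fun t => complex.Re (f t)) /\
  measurable_fun [set: T] (fun t => complex.Im (f t)).

Lemma cmeasurable_cst c : cmeasurable (fun=> c).
Proof. by split; exact: measurable_cst. Qed.

Lemma cmeasurableD f g : cmeasurable f -> cmeasurable g ->
  cmeasurable (fun t => f t + g t).
Proof.
move=> [f1 f2] [g1 g2]; split.
- rewrite (_ : (fun _ => _) =
    (fun t => complex.Re (f t)) \+ (fun t => complex.Re (g t))).
    exact: measurable_funD.
  by apply/funext => t /=; case: (f t) (g t) => [? ?] [].
- rewrite (_ : (fun _ => _) =
    (fun t => complex.Im (f t)) \+ (fun t => complex.Im (g t))).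
    exact: measurable_funD.
  by apply/funext => t /=; case: (f t) (g t) => [? ?] [].
Qed.

Lemma cmeasurableM f g : cmeasurable f -> cmeasurable g ->
  cmeasurable (fun t => f t * g t).
Proof.
move=> [f1 f2] [g1 g2]; split.
- rewrite (_ : (fun _ => _) =
    (fun t => complex.Re (f t) * complex.Re (g t)
              - complex.Im (f t) * complex.Im (g t))).
    by apply: measurable_funB; exact: measurable_funM.
  by apply/funext => t /=; case: (f t) (g t) => [? ?] [].
- rewrite (_ : (fun _ => _) =
    (fun t => complex.Re (f t) * complex.Im (g t)
              + complex.Im (f t) * complex.Re (g t))).
    by apply: measurable_funD; exact: measurable_funM.
  by apply/funext => t /=; case: (f t) (g t) => [? ?] [].
Qed.

Lemma measurable_normc f : cmeasurable f ->
  measurable_fun [set: T] (cmod \o f).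
Proof.
move=> [f1 f2].
rewrite (_ : _ \o _ = @Num.sqrt R \o (fun t => complex.Re (f t) ^+ 2
                                         + complex.Im (f t) ^+ 2)).
  apply: measurableT_comp.
    apply: continuous_measurable_fun; exact: sqrt_continuous.
  by apply: measurable_funD; exact: measurable_funX.
by apply/funext => t /=; case: (f t).
Qed.

End ComplexMeasurable.

Section L2.
Context d (T : measurableType d) (R : realType).
Variable mu : {measure set T -> \bar R}.
Implicit Types f g : T -> R[i].

Local Notation N f := ('N[mu]_2%:E[EFin \o (cmod \o f)]%E).

Lemma Lnorm2E f : N f = ((\int[mu]_x ((cmod (f x) `^ 2)%:E)) `^ 2^-1)%E.
Proof.
rewrite unlock; congr (_ `^ _)%E; apply: eq_integral => x _ /=.
by rewrite ger0_norm ?cmod_ge0.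
Qed.

Lemma measurable_cmodX f : cmeasurable f ->
  measurable_fun [set: T] (fun x => (cmod (f x) `^ 2)%:E).
Proof.
move=> mf; apply/measurable_EFinP.
apply: (@measurableT_comp _ _ _ _ _ _ (@powR R ^~ 2)) => //.
exact: measurable_normc.
Qed.

Lemma ae_eq_Lnorm2 f g : cmeasurable f -> cmeasurable g ->
  f = g %[ae mu] -> N f = N g.
Proof.
move=> mf mg fg; rewrite !Lnorm2E; congr (_ `^ _)%E.
apply: ae_eq_integral => //; [exact: measurable_cmodX|exact: measurable_cmodX|].
by apply: filterS fg => x /[apply] ->.
Qed.

Lemma Lnorm2D_le f g : cmeasurable f -> cmeasurable g ->
  (N (fun t => f t + g t)%R <= N f + N g)%E.
Proof.
move=> mf mg; apply: (@le_trans _ _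
  'N[mu]_2%:E[EFin \o ((cmod \o f) \+ (cmod \o g))%R]%E); last first.
  by apply: eminkowski; rewrite ?lee_fin ?ler1n//; exact: measurable_normc.
rewrite Lnorm2E unlock; apply: gt0_ler_poweR.
- by rewrite invr_ge0.
- by rewrite in_itv/= leey integral_ge0// => x _; rewrite lee_fin powR_ge0.
- by rewrite in_itv/= leey integral_ge0// => x _; rewrite poweR_ge0.
apply: ge0_le_integral => //.
- by move=> x _; rewrite lee_fin powR_ge0.
- exact/measurable_cmodX/cmeasurableD.
- apply: (@measurableT_comp _ _ _ _ _ _ (@poweR R ^~ 2)).
    exact: measurable_poweR.
  apply: measurableT_comp => //; apply/measurable_EFinP.
  by apply: measurable_funD; exact: measurable_normc.
move=> x _ /=; rewrite lee_fin ger0_norm ?addr_ge0 ?cmod_ge0//.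
by rewrite ge0_ler_powR ?nnegrE ?addr_ge0 ?cmod_ge0// le_normcD.
Qed.

Lemma Lnorm2Z a f : cmeasurable f -> finite_norm mu 2%:E (cmod \o f) ->
  (N (fun t => a * f t)%R = (cmod a)%:E * N f)%E.
Proof.
move=> mf fi; rewrite Lnorm2E.
have NN0 : (0 <= cmod a `^ 2) by rewrite powR_ge0.
under eq_integral => x _ do rewrite Normc.normcM powRM ?cmod_ge0// EFinM.
rewrite ge0_integralZl//; last 2 first.
- exact: measurable_cmodX.
- by move=> x _; rewrite lee_fin powR_ge0.
rewrite poweRM ?lee_fin//; last first.
  by apply: integral_ge0 => x _; rewrite lee_fin powR_ge0.
by rewrite -Lnorm2E poweR_EFin -powRrM mulfV ?pnatr_eq0// powRr1 ?cmod_ge0.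
Qed.

(* Square-integrable measurable functions: representatives of the classes. *)
Definition L2pred : {pred (T -> R[i])} :=
  mem [set f : T -> R[i] | cmeasurable f /\ finite_norm mu 2%:E (cmod \o f)].

Lemma L2predP f :
  f \in L2pred <-> cmeasurable f /\ finite_norm mu 2%:E (cmod \o f).
Proof. by rewrite inE. Qed.

Lemma L2pred_submod_closed : submod_closed L2pred.
Proof.
split.
  apply/L2predP; split; first exact: cmeasurable_cst.
  rewrite /finite_norm (_ : _ \o _ = cst 0); last first.
    by apply/funext => t /=; congr EFin; exact: Normc.normc0.
  rewrite Lnorm0; first by rewrite ltry.
  by apply/eqP => -[] /eqP; rewrite pnatr_eq0.
move=> a f g /L2predP[mf nf] /L2predP[mg ng].
have maf : cmeasurable (fun t => a * f t).
  by apply: cmeasurableM => //; exact: cmeasurable_cst.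
apply/L2predP; split; first exact: (cmeasurableD maf mg).
apply: le_lt_trans (Lnorm2D_le maf mg) _; rewrite lte_add_pinfty// Lnorm2Z//.
by rewrite lte_mul_pinfty ?lee_fin ?cmod_ge0.
Qed.

HB.instance Definition _ :=
  GRing.isSubmodClosed.Build R[i] (T -> R[i]) L2pred L2pred_submod_closed.

Record L2fun := MkL2fun {
  L2fun_val :> T -> R[i];
  L2fun_valP : L2fun_val \in L2pred }.

HB.instance Definition _ := [isSub for L2fun_val].
HB.instance Definition _ := [Choice of L2fun by <:].
HB.instance Definition _ := [SubChoice_isSubLmodule of L2fun by <:].

Lemma L2fun_valB (f g : L2fun) t : (f - g) t = f t - g t.
Proof. by []. Qed.

Lemma L2fun_valZD a (f g : L2fun) t : (a *: f + g) t = a * f t + g t.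
Proof. by []. Qed.

Definition L2null : {pred L2fun} :=
  mem [set f : L2fun | {ae mu, forall t, f t = 0}].

Lemma L2nullP (f : L2fun) : f \in L2null <-> {ae mu, forall t, f t = 0}.
Proof. by rewrite inE. Qed.

Lemma L2null_zmod_closed : zmod_closed L2null.
Proof.
split; first by apply/L2nullP; exact: aeW.
move=> f g /L2nullP f0 /L2nullP g0; apply/L2nullP.
by apply: filterS2 f0 g0 => t f0 g0; rewrite L2fun_valB f0 g0 subrr.
Qed.

HB.instance Definition _ :=
  GRing.isZmodClosed.Build L2fun L2null L2null_zmod_closed.

Definition L2 : Type := Quotient.quot L2null.

HB.instance Definition _ := GRing.Zmodule.on L2.
HB.instance Definition _ : EqQuotient L2fun (Quotient.equiv L2null) L2 :=
  EqQuotient.on L2.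

Implicit Types x y : L2.

Lemma L2_eqP (f g : L2fun) :
  \pi_L2 f = \pi_L2 g <-> {ae mu, forall t, f t = g t}.
Proof.
have -> : (\pi_L2 f = \pi_L2 g) <-> f - g \in L2null.
  rewrite Quotient.idealrBE; split => [->//|/eqP//].
rewrite L2nullP; split; apply: filterS => t.
  by rewrite L2fun_valB => /eqP; rewrite subr_eq0 => /eqP.
by move=> fg; rewrite L2fun_valB fg subrr.
Qed.

Lemma L2_reprK (f : L2fun) : {ae mu, forall t, (repr (\pi_L2 f)) t = f t}.
Proof. by apply/L2_eqP; rewrite reprK. Qed.

Definition L2scale (a : R[i]) x : L2 := \pi_L2 (a *: repr x).

Lemma pi_L2scale a (f : L2fun) : L2scale a (\pi_L2 f) = \pi_L2 (a *: f).
Proof.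
apply/L2_eqP; apply: filterS (L2_reprK f) => t ft.
by rewrite -[LHS]/(a * (repr (\pi_L2 f)) t) ft.
Qed.

Lemma pi_L2D (f g : L2fun) : \pi_L2 f + \pi_L2 g = \pi_L2 (f + g).
Proof. exact/esym/(@Quotient.pi_add _ L2null). Qed.

Lemma L2scaleA a b x : L2scale a (L2scale b x) = L2scale (a * b) x.
Proof.
by elim/quotW: x => f; rewrite (pi_L2scale b) !pi_L2scale scalerA.
Qed.

Lemma L2scale1 : left_id 1 L2scale.
Proof. by elim/quotW => f; rewrite pi_L2scale scale1r. Qed.

Lemma L2scaleDr : right_distributive L2scale +%R.
Proof.
move=> a; elim/quotW => f; elim/quotW => g.
by rewrite pi_L2D !pi_L2scale pi_L2D scalerDr.
Qed.

Lemma L2scaleDl x : {morph L2scale^~ x : a b / a + b}.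
Proof. by move=> a b; elim/quotW: x => f; rewrite !pi_L2scale pi_L2D scalerDl. Qed.

HB.instance Definition _ := GRing.Zmodule_isLmodule.Build R[i] L2
  L2scaleA L2scale1 L2scaleDr L2scaleDl.

Lemma pi_L2Z a (f : L2fun) : a *: \pi_L2 f = \pi_L2 (a *: f).
Proof. exact: pi_L2scale. Qed.

(* The norm of a normed module over R[i] takes its values in R[i]. *)
Definition L2norm x : R[i] :=
  (fine 'N[mu]_2%:E[EFin \o (cmod \o repr x)])%:C%C.

Lemma L2fun_measurable (f : L2fun) : cmeasurable f.
Proof. by have /L2predP[] := L2fun_valP f. Qed.

Lemma L2fun_finite (f : L2fun) : finite_norm mu 2%:E (cmod \o f).
Proof. by have /L2predP[] := L2fun_valP f. Qed.

Lemma fine_Lnorm2 (f : L2fun) : (fine (N f))%:E = N f.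
Proof.
by rewrite fineK// fin_numElt (lt_le_trans ltNy0) ?Lnorm_ge0//=; exact: L2fun_finite.
Qed.

Lemma L2norm_pi (f : L2fun) :
  L2norm (\pi_L2 f) = (fine 'N[mu]_2%:E[EFin \o (cmod \o f)])%:C%C.
Proof.
rewrite /L2norm; congr (fine _)%:C%C.
apply: ae_eq_Lnorm2; [exact: L2fun_measurable|exact: L2fun_measurable|].
by apply: filterS (L2_reprK f) => t + _.
Qed.

Lemma ler_L2normD x y : L2norm (x + y) <= L2norm x + L2norm y.
Proof.
elim/quotW: x => f; elim/quotW: y => g.
rewrite pi_L2D !L2norm_pi -rmorphD/= lecR.
have fg : (N (f + g : L2fun)%R <= N f + N g)%E.
  exact: Lnorm2D_le (L2fun_measurable f) (L2fun_measurable g).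
by move: fg; rewrite -(fine_Lnorm2 (f + g)) -(fine_Lnorm2 f) -(fine_Lnorm2 g).
Qed.

Lemma L2normZ a x : L2norm (a *: x) = `|a| * L2norm x.
Proof.
elim/quotW: x => f; rewrite pi_L2Z !L2norm_pi.
have af : N (a *: f : L2fun)%R = ((cmod a)%:E * N f)%E.
  exact: Lnorm2Z (L2fun_measurable f) (L2fun_finite f).
have -> : `|a| = (cmod a)%:C%C by [].
rewrite -rmorphM/=; congr (_%:C%C); apply: EFin_inj.
by rewrite EFinM; move: af; rewrite -(fine_Lnorm2 (a *: f)) -(fine_Lnorm2 f).
Qed.

Lemma L2norm0_eq0 x : L2norm x = 0 -> x = 0.
Proof.
elim/quotW: x => f; rewrite L2norm_pi => /complexI N0.
have : 'N[mu]_2%:E[EFin \o (cmod \o f)]%E = 0%E.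
  by rewrite -[LHS]fine_Lnorm2; congr EFin.
move=> /Lnorm_eq0_eq0 f0.
have -> : 0 = \pi_L2 0 :> L2.
  by rewrite -[LHS]/(Quotient.zero L2null) /Quotient.zero; unlock.
apply/L2_eqP.
have {}f0 : EFin \o (cmod \o f) = \0%E %[ae mu].
  apply: f0; last by rewrite lte_fin.
  by apply/measurable_EFinP; exact/measurable_normc/L2fun_measurable.
by apply: filterS f0 => t /(_ I) [] /Normc.eq0_normc.
Qed.

HB.instance Definition _ := Lmodule_isNormed.Build R[i] L2
  ler_L2normD L2normZ L2norm0_eq0.

Lemma normL2E x : `|x| = L2norm x. Proof. by []. Qed.

Section Multiplication.
Variable v : T -> R[i].

(* [repr x] is a square-integrable representative of the class x; when v is
   measurable, neither definition depends on its choice. *)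
Definition mulop_dom : set L2 :=
  [set x : L2 | (fun t => v t * repr x t) \in L2pred].

Definition mulop_fun (x : L2) : L2 :=
  if pselect (mulop_dom x) is left vx then \pi_L2 (MkL2fun vx) else 0.

Hypothesis mv : cmeasurable v.

Lemma mulop_domE (f : L2fun) :
  mulop_dom (\pi_L2 f) <-> (fun t => v t * f t) \in L2pred.
Proof.
have ae : (fun t => v t * f t) = (fun t => v t * repr (\pi_L2 f) t) %[ae mu].
  by apply: filterS (L2_reprK f) => t ->.
rewrite /mulop_dom /= !L2predP /finite_norm.
have m1 : cmeasurable (fun t => v t * f t).
  exact: cmeasurableM (L2fun_measurable f).
have m2 : cmeasurable (fun t => v t * repr (\pi_L2 f) t).
  exact: cmeasurableM (L2fun_measurable _).
by rewrite -[X in _ /\ is_true (X < _)%E <-> _](ae_eq_Lnorm2 m1 m2 ae); split=> -[].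
Qed.

Lemma pi_mulop (f : L2fun) (vf : (fun t => v t * f t) \in L2pred) :
  mulop_fun (\pi_L2 f) = \pi_L2 (MkL2fun vf).
Proof.
rewrite /mulop_fun; case: pselect => [vx|]; last by case; exact/mulop_domE.
by apply/L2_eqP; apply: filterS (L2_reprK f) => t /= ->.
Qed.

Lemma mulfunZD a (f g : L2fun) : (fun t => v t * (a *: f + g) t) =
  a *: (fun t => v t * f t) + (fun t => v t * g t).
Proof.
apply/funext => t; by rewrite L2fun_valZD mulrDr mulrCA.
Qed.

Lemma mulop_dom0 : mulop_dom 0.
Proof.
rewrite -[0]/(Quotient.zero L2null) /Quotient.zero; unlock.
apply/mulop_domE; rewrite (_ : (fun _ => _) = 0) ?rpred0//.
by apply/funext => t /=; exact: mulr0.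
Qed.

Lemma mulop_domP a x y :
  mulop_dom x -> mulop_dom y -> mulop_dom (a *: x + y).
Proof.
elim/quotW: x => f; elim/quotW: y => g.
rewrite pi_L2Z pi_L2D !mulop_domE mulfunZD => vf vg.
by rewrite rpredD// rpredZ.
Qed.

Lemma mulop_linear a x y : mulop_dom x -> mulop_dom y ->
  mulop_fun (a *: x + y) = a *: mulop_fun x + mulop_fun y.
Proof.
elim/quotW: x => f; elim/quotW: y => g.
rewrite pi_L2Z pi_L2D !mulop_domE => vf vg.
have vfg : (fun t => v t * (a *: f + g) t) \in L2pred.
  by rewrite mulfunZD rpredD// rpredZ.
rewrite (pi_mulop vfg) (pi_mulop vf) (pi_mulop vg) pi_L2Z pi_L2D.
congr (\pi_L2 _); apply/val_inj => /=; exact: mulfunZD.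
Qed.

Definition mulop : operator L2 :=
  Operator mulop_dom0 mulop_domP mulop_linear.

End Multiplication.

End L2.

(* Main.v *)
Require Import Defs.
From mathcomp Require Import all_boot all_order all_algebra complex.
From mathcomp Require Import all_classical all_reals all_analysis.
From mathcomp Require Import measurable_realfun.

Set Implicit Arguments.
Unset Strict Implicit.
Unset Printing Implicit Defensive.

Import Order.TTheory GRing.Theory Num.Theory.
Import numFieldNormedType.Exports.

Local Open Scope classical_set_scope.
Local Open Scope ring_scope.

(** The powers of M_v are the multiplications by the powers of v: if f is in
    the domain of M_v^n, then M_v^i f is represented by v^i f for all i <= n
    ([op_exp_mulop]). Taking squared norms and summing under the integral
    sign therefore turns Theta into a weighted integral ([Theta_mulop]):

      Theta_n(f) = int triangle_(v,n) |f|^2 dmu   for f in D(M_v^n).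

    If triangle_(v,n) <= 0 almost everywhere, the integrand is almost
    everywhere nonpositive and so is Theta_n(f). Conversely, if Theta_n <= 0 on
    the domain of M_v^n, test it on the indicator function of a set A of finite
    measure on which v is bounded and triangle_(v,n) > 0: this function is in
    the domain because every v^i is bounded on A, and
    int_A triangle_(v,n) dmu <= 0 is only possible if A is null
    ([triangle_le0_on]). By sigma-finiteness, countably many sets on which v is
    bounded and mu is finite cover the space, so triangle_(v,n) <= 0 almost
    everywhere. The resulting equivalence for a single n
    ([Theta_le0_triangle]) is (i) when read for n = 1, ..., k.

    For (ii) it is read for all n >= 1 at once, the countably many null sets
    being gathered into one. What remains is pointwise: the alternating sum
    that starts at m in the sequence |v(t)|^(2n) is
    |v(t)|^(2m) triangle_(v,n)(t), so it suffices to look at m = 0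
    ([completely_alternating_triangle]). *)

(** * Powers, moduli and alternating sums *)

Lemma op_dom_exp_le (K : numFieldType) (V : normedModType K) (S : operator V)
    (f : V) (n i : nat) :
  (i <= n)%N -> op_dom (op_exp S n) f -> op_dom (op_exp S i) f.
Proof.
move=> /subnK <-; elim: (n - i)%N => [//|j IHj] [domf _].
exact: IHj.
Qed.

Lemma normcX (R : realType) (z : R[i]) n : cmod (z ^+ n) = cmod z ^+ n.
Proof.
elim: n => [|n IHn]; first by rewrite !expr0 Normc.normc1.
by rewrite !exprS Normc.normcM IHn.
Qed.

Lemma cmeasurableX d (T : measurableType d) (R : realType) (v : T -> R[i]) n :
  cmeasurable v -> cmeasurable (fun t => v t ^+ n).
Proof.
move=> mv; elim: n => [|n IHn]; first exact: cmeasurable_cst.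
by under eq_fun do rewrite exprS; exact: cmeasurableM.
Qed.

(** The pointwise identity behind the integral formula for Theta: the terms of
    the right-hand side integrate to the squared norms of the v^i f. *)
Lemma triangleM (R : realType) (T : Type) (v : T -> R[i]) n t (z : R[i]) :
  triangle v n t * cmod z ^+ 2 =
  \sum_(i < n.+1) (-1) ^+ i * 'C(n, i)%:R * cmod (v t ^+ i * z) ^+ 2.
Proof.
rewrite /triangle big_mkord mulr_suml; apply: eq_bigr => i _.
by rewrite Normc.normcM normcX exprMn -exprM (mulnC i) !mulrA.
Qed.

(** The sum that starts at m is the one that starts at 0 multiplied by
    |v(t)|^(2m) >= 0, so all the inequalities follow from those with m = 0. *)
Lemma completely_alternating_triangle (R : realType) (T : Type)
    (v : T -> R[i]) t :
  completely_alternating (fun n => cmod (v t) ^+ (2 * n)) <->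
  forall n, (1 <= n)%N -> triangle v n t <= 0.
Proof.
split=> [ca n n1|tr m n n1]; first exact: (ca 0 n n1).
rewrite (_ : \sum_(_ <= _ < _) _ = triangle v n t * cmod (v t) ^+ (2 * m)).
  by rewrite mulr_le0_ge0 ?tr ?exprn_ge0 ?cmod_ge0.
rewrite /triangle mulr_suml; apply: eq_bigr => i _.
by rewrite mulnDr exprD mulrA mulrAC.
Qed.

Lemma measurable_triangle d (T : measurableType d) (R : realType)
    (v : T -> R[i]) n :
  cmeasurable v -> measurable_fun setT (triangle v n).
Proof.
move=> mv; apply: measurable_sum => i; apply: measurable_funM => //.
apply: measurable_funX; exact: (measurable_normc mv).
Qed.

(** * Real-valued integrals *)

Section RealIntegral.
Context d (T : measurableType d) (R : realType).
Variable mu : {measure set T -> \bar R}.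

Lemma Rintegral_sum I (s : seq I) (h : I -> T -> R) :
  (forall i, mu.-integrable setT (EFin \o h i)) ->
  \int[mu]_x \sum_(i <- s) h i x = \sum_(i <- s) \int[mu]_x h i x.
Proof.
move=> hi; rewrite {1}/Rintegral.
under eq_integral do rewrite -sumEFin.
rewrite integral_sum//.
under eq_bigr => i _ do
  rewrite -[(\int[mu]_x _)%E]fineK ?(integrable_fin_num _ (hi i))//.
by rewrite sumEFin.
Qed.

(** Such an h is almost everywhere equal to -|h|, whose integral is nonpositive
    even when it diverges. *)
Lemma Rintegral_ae_le0 (h : T -> R) :
  measurable_fun setT h -> {ae mu, forall t, h t <= 0} ->
  \int[mu]_t h t <= 0.
Proof.
move=> mh hN; rewrite /Rintegral.
rewrite (@ae_eq_integral _ _ _ mu _ (fun t => - (`|h t|%:E)))%E//.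
- by rewrite integral_ge0N ?fineN ?oppr_le0 ?fine_ge0 ?integral_ge0.
- exact/measurable_EFinP.
- apply/measurableT_comp => //; apply/measurable_EFinP.
  exact: measurableT_comp.
- by apply: filterS hN => t hN _; rewrite ler0_norm// -EFinN opprK.
Qed.

End RealIntegral.

(** * Square-integrable functions *)

Section SquareIntegrable.
Context d (T : measurableType d) (R : realType).
Variable mu : {measure set T -> \bar R}.

Lemma Lnorm2_sqr (f : T -> R[i]) :
  ('N[mu]_2%:E[EFin \o (cmod \o f)] `^ 2 =
   \int[mu]_x (cmod (f x) ^+ 2)%:E)%E.
Proof.
rewrite poweR_Lnorm ?pnatr_eq0//; apply: eq_integral => x _ /=.
by rewrite ger0_norm ?cmod_ge0// powR_mulrn ?cmod_ge0.
Qed.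

(** Membership in L2 in terms of integrability, the form in which sums can be
    taken out of integrals. *)
Lemma L2pred_integrable (f : T -> R[i]) :
  f \in L2pred mu <->
  cmeasurable f /\ mu.-integrable setT (fun x => (cmod (f x) ^+ 2)%:E).
Proof.
rewrite L2predP; split=> -[mf nf]; split => //.
  apply/integrableP; split.
    apply/measurable_EFinP; apply: measurable_funX; exact: measurable_normc.
  rewrite (eq_integral (fun x => (cmod (f x) ^+ 2)%:E)).
    by rewrite -Lnorm2_sqr poweR_lty.
  by move=> x _; rewrite gee0_abs// lee_fin exprn_ge0 ?cmod_ge0.
have /integrableP[_] := nf.
rewrite (eq_integral (fun x => (cmod (f x) ^+ 2)%:E)).
  by rewrite -Lnorm2_sqr; apply: lty_poweRy; rewrite pnatr_eq0.
by move=> x _; rewrite gee0_abs// lee_fin exprn_ge0 ?cmod_ge0.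
Qed.

Lemma sqr_norm_pi (f : L2fun mu) :
  `|\pi_(L2 mu)%qT f| ^+ 2 = (\int[mu]_x (cmod (f x) ^+ 2))%:C%C.
Proof.
rewrite normL2E L2norm_pi -rmorphXn; congr (_%:C%C).
rewrite /Rintegral -Lnorm2_sqr fine_poweR powR_mulrn//.
by rewrite fine_ge0 ?Lnorm_ge0.
Qed.

Lemma cmeasurable_indic (A : set T) : measurable A ->
  cmeasurable (fun t => (\1_A t : R)%:C%C).
Proof.
by move=> mA; split => /=; [exact: measurable_indic | exact: measurable_cst].
Qed.

(** Source of test functions: |g 1_A|^2 is dominated by c^2 1_A, which is
    integrable. The bound is local to A because g will be a power of v, which
    may be unbounded. *)
Lemma bounded_on_L2pred (A : set T) (g : T -> R[i]) (c : R) :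
  measurable A -> (mu A < +oo)%E -> cmeasurable g ->
  (forall t, A t -> cmod (g t) <= c) ->
  (fun t => g t * (\1_A t : R)%:C%C) \in L2pred mu.
Proof.
move=> mA Afin mg gc.
have mgA : cmeasurable (fun t => g t * (\1_A t : R)%:C%C).
  by apply: cmeasurableM => //; exact: cmeasurable_indic.
apply/L2pred_integrable; split=> //.
pose h x : \bar R := ((c ^+ 2)%:E * (\1_A x)%:E)%E.
apply: (@le_integrable _ _ _ _ _ _ _ h) => //.
- apply/measurable_EFinP; apply: measurable_funX; exact: measurable_normc.
- move=> x _; rewrite /h -EFinM !abse_EFin lee_fin indicE.
  have [xA|_] := boolP (x \in A); last first.
    by rewrite mulr0 Normc.normc0 mulr0 expr0n.
  rewrite !mulr1 !normrX ler_pXn2r ?nnegrE// !ger0_norm ?cmod_ge0//.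
    by apply: gc; rewrite inE in xA.
  by apply: le_trans (gc _ (set_mem xA)); exact: cmod_ge0.
- apply: integrableZl => //; apply/integrableP; split.
    exact/measurable_EFinP.
  rewrite (eq_integral (fun x => (\1_A x)%:E)).
    by rewrite integral_indic// setIT.
  by move=> t _; rewrite gee0_abs// lee_fin.
Qed.

End SquareIntegrable.

(** * Powers of a multiplication operator *)

Section MultiplicationPowers.
Context d (T : measurableType d) (R : realType).
Variable mu : {measure set T -> \bar R}.
Variables (v : T -> R[i]) (mv : cmeasurable v).

(** The representative g equals v^n f everywhere and not only almost
    everywhere, which lets the induction go through without null sets. *)
Lemma op_exp_mulop n (f : L2fun mu) :
  op_dom (op_exp (mulop mu mv) n) (\pi_(L2 mu)%qT f) ->
  exists2 g : L2fun mu,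
    op_exp (mulop mu mv) n (\pi_(L2 mu)%qT f) = \pi_(L2 mu)%qT g &
    forall t, g t = v t ^+ n * f t.
Proof.
elim: n => [|n IHn] /=; first by exists f => // t; rewrite expr0 mul1r.
move=> [/IHn[g -> gE]] /(mulop_domE mv) vg.
exists (MkL2fun vg); first exact: pi_mulop.
by move=> t /=; rewrite gE exprS mulrA.
Qed.

(** The domain of M_v^n is defined by iteration, so all the products v^i f with
    i <= n have to be square-integrable, not only v^n f. *)
Lemma op_dom_exp_mulop n (f : L2fun mu) :
  (forall i, (i <= n)%N -> (fun t => v t ^+ i * f t) \in L2pred mu) ->
  op_dom (op_exp (mulop mu mv) n) (\pi_(L2 mu)%qT f).
Proof.
elim: n => [//|n IHn] vf.
have domn := IHn (fun i ilen => vf i (leqW ilen)).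
split=> //.
have [g -> gE] := op_exp_mulop domn.
apply/(mulop_domE mv); rewrite (_ : (fun _ => _) = fun t => v t ^+ n.+1 * f t).
  exact: vf.
by apply/funext => t; rewrite gE exprS mulrA.
Qed.

(** The bridge between the operator and the function: each of the finitely many
    terms of Theta is the integral of |v^i f|^2, which is finite on the domain,
    so the sum may be taken under the integral sign. *)
Lemma Theta_mulop n (f : L2fun mu) :
  op_dom (op_exp (mulop mu mv) n) (\pi_(L2 mu)%qT f) ->
  mu.-integrable setT (fun t => (triangle v n t * cmod (f t) ^+ 2)%:E) /\
  Theta (mulop mu mv) n (\pi_(L2 mu)%qT f) =
    (\int[mu]_t (triangle v n t * cmod (f t) ^+ 2))%:C%C.
Proof.
move=> domf.
have pow (i : 'I_n.+1) := op_exp_mulop (op_dom_exp_le (leq_ord i) domf).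
have int (i : 'I_n.+1) :
    mu.-integrable setT (fun t => (cmod (v t ^+ i * f t) ^+ 2)%:E).
  have [g _ gE] := pow i.
  have /L2pred_integrable[_] := L2fun_valP g.
  by apply: eq_integrable => // t _; rewrite gE.
have intc (i : 'I_n.+1) : mu.-integrable setT (EFin \o (fun t =>
    (-1) ^+ i * 'C(n, i)%:R * cmod (v t ^+ i * f t) ^+ 2)).
  exact: (integrableZl measurableT ((-1) ^+ i * 'C(n, i)%:R) (int i)).
split.
  under eq_fun do rewrite triangleM -sumEFin.
  by apply: integrable_sum => // i _; exact: intc.
under eq_Rintegral do rewrite triangleM.
rewrite Rintegral_sum// rmorph_sum/= /Theta big_mkord; apply: eq_bigr => i _.
have [g gpi gE] := pow i.
rewrite gpi sqr_norm_pi RintegralZl//; last exact: int.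
rewrite !rmorphM/= rmorphXn rmorphN rmorph1 rmorph_nat.
by congr (_ * _%:C%C); apply: eq_Rintegral => t _; rewrite gE.
Qed.

End MultiplicationPowers.

(** * Sign of Theta against sign of the alternating sum *)

Section ThetaTriangle.
Context d (T : measurableType d) (R : realType).
Variables (v : T -> R[i]) (mv : cmeasurable v).

(** The test function is the indicator of the part A of F where |v| <= c and
    the alternating sum is positive. The integrand of Theta is then nonnegative
    with nonpositive integral, hence vanishes almost everywhere; as it is
    positive on A, A is null. *)
Lemma triangle_le0_on (mu : {measure set T -> \bar R}) n (F : set T) (c : R) :
  measurable F -> (mu F < +oo)%E ->
  (forall f, op_dom (op_exp (mulop mu mv) n) f ->
     Theta (mulop mu mv) n f <= 0) ->
  {ae mu, forall t, F t -> cmod (v t) <= c -> triangle v n t <= 0}.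
Proof.
move=> mF Ffin ThetaN.
pose A := F `&` [set t | cmod (v t) <= c] `&` [set t | 0 < triangle v n t].
have mA : measurable A.
  apply: measurableI; first apply: measurableI => //.
    rewrite -[X in measurable X]setTI; apply: measurable_fun_le => //.
    exact: measurable_normc.
  rewrite -[X in measurable X]setTI.
  have mtr := measurable_triangle n mv.
  have := measurable_fun_ltr (@measurable_cst _ _ _ _ setT (0 : R)) mtr.
  by move=> /(_ measurableT [set true]); exact.
have Afin : (mu A < +oo)%E.
  by apply: le_lt_trans Ffin; rewrite le_measure ?inE// => t [[]].
have vA i : (fun t => v t ^+ i * (\1_A t : R)%:C%C) \in L2pred mu.
  apply: (@bounded_on_L2pred _ _ _ _ _ _ (c ^+ i)) => //.
    exact: cmeasurableX.
  move=> t [[_ /= vtc] _]; rewrite normcX.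
  by rewrite lerXn2r ?nnegrE ?cmod_ge0// (le_trans (cmod_ge0 _) vtc).
have L2A : (fun t => (\1_A t : R)%:C%C) \in L2pred mu.
  by have := vA 0%N; under eq_fun do rewrite expr0 mul1r.
pose f := MkL2fun L2A.
have domf : op_dom (op_exp (mulop mu mv) n) (\pi_(L2 mu)%qT f).
  by apply: op_dom_exp_mulop => i _; exact: vA.
have [int ThetaE] := Theta_mulop domf.
have hE t : triangle v n t * cmod (f t) ^+ 2 = triangle v n t * \1_A t.
  rewrite [f t]/= indicE; case: (t \in A).
    by rewrite Normc.normc1 expr1n.
  by rewrite Normc.normc0 expr0n.
have h0 t : 0 <= triangle v n t * cmod (f t) ^+ 2.
  rewrite hE indicE; have [|_] := boolP (t \in A); last by rewrite mulr0.
  by rewrite inE => -[_ /= /ltW]; rewrite mulr1.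
have := ThetaN _ domf; rewrite ThetaE (_ : 0 = 0%:C%C)// lecR => int_le0.
have {int_le0} int0 :
    (\int[mu]_t `|(triangle v n t * cmod (f t) ^+ 2)%:E|)%E = 0%E.
  rewrite (eq_integral (fun t => (triangle v n t * cmod (f t) ^+ 2)%:E)).
    rewrite -[LHS]fineK; last exact: integrable_fin_num.
    congr EFin; apply/eqP; rewrite eq_le [X in X && _]int_le0/=.
    by rewrite Rintegral_ge0.
  by move=> t _; rewrite gee0_abs// lee_fin.
have /integrableP[mh _] := int.
have := (ae_eq_integral_abs mu measurableT mh).1 int0.
apply: filterS => t /(_ I) [] h0t Ft vtc; rewrite leNgt; apply/negP => tr0.
have : t \in A by rewrite inE.
move: h0t; rewrite hE indicE => /[swap] -> /eqP.
by rewrite mulr1 gt_eqF.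
Qed.

(** The null set of the direct implication is a countable union over the pieces
    F_i of a sigma-finite cover and over the bounds j on |v|. *)
Lemma Theta_le0_triangle (mu : {sigma_finite_measure set T -> \bar R}) n :
  (forall f, op_dom (op_exp (mulop mu mv) n) f ->
     Theta (mulop mu mv) n f <= 0) <->
  {ae mu, forall t, triangle v n t <= 0}.
Proof.
split=> [ThetaN|trN].
  have [F FT /all_and2[mF Ffin]] := sigma_finiteT mu.
  have : {ae mu, forall t, forall i j, F i t -> cmod (v t) <= j%:R ->
                             triangle v n t <= 0}.
    apply/ae_foralln => i; apply/ae_foralln => j.
    exact: triangle_le0_on (mF i) (Ffin i) ThetaN.
  apply: filterS => t trt.
  have [i _ Fit] : (\bigcup_i F i) t by rewrite -FT.
  apply: (trt i (Num.truncn (cmod (v t))).+1) => //.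
  exact/ltW/truncnS_gt.
elim/quotW => f domf; have [int ->] := Theta_mulop domf.
rewrite (_ : 0 = 0%:C%C)// lecR; apply: Rintegral_ae_le0.
  by apply/measurable_EFinP; have /integrableP[] := int.
by apply: filterS trN => t trN; rewrite mulr_le0_ge0 ?exprn_ge0 ?cmod_ge0.
Qed.

End ThetaTriangle.

Theorem corollary3p9 (d : measure_display) (T : measurableType d)
    (R : realType) (mu : {sigma_finite_measure set T -> \bar R})
    (v : T -> R[i]) (mv : cmeasurable v) (k : nat) (k1 : (1 <= k)%N) :
  dense (op_dom (mulop mu mv)) ->
  (hyperexpansive k (mulop mu mv) <->
    forall n, (1 <= n <= k)%N -> {ae mu, forall t, triangle v n t <= 0}) /\
  (completely_hyperexpansive (mulop mu mv) <->
    {ae mu, forall t,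
      completely_alternating (fun n => cmod (v t) ^+ (2 * n))}).
Proof.
move=> _; split.
  by split=> H n n1k; [exact/Theta_le0_triangle/H|exact/Theta_le0_triangle/H].
split=> [ch|ca n n1].
  have : {ae mu, forall t n, (1 <= n)%N -> triangle v n t <= 0}.
    apply/ae_foralln => n; have [n1|_] := boolP (1 <= n)%N; last exact: aeW.
    by apply: filterS (proj1 (Theta_le0_triangle mv mu n) (ch n n1)) => t.
  by apply: filterS => t trt; apply/completely_alternating_triangle.
apply/Theta_le0_triangle; apply: filterS ca => t.
by move=> /completely_alternating_triangle; exact.
Qed.
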